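(* Let $\Gamma(G)$ be a connected signed graph on $n$ vertices, let $v$ be a cut-point of $\Gamma(G)$ and let $\Gamma(G_1)$ be a connected component of $\Gamma(G-v)$. If $\eta(\Gamma(G_1))=\eta(\Gamma(G_1+v))-1$, then $\eta(\Gamma(G))=\eta(\Gamma(G_1))+\eta(\Gamma(G-G_1))$.
   Context: A signed graph $\Gamma(G)=(G,\sigma)$ consists of a simple graph $G=(V,E)$ and a map $\sigma:E\to\{+,-\}$; its adjacency matrix has $(i,j)$ entry $\sigma(v_iv_j)$ if $v_iv_j\in E$ and $0$ otherwise, and its nullity $\eta(\Gamma(G))$ is the multiplicity of the eigenvalue $0$ of this matrix. Subgraphs inherit signs. A cut-point is a vertex whose removal disconnects $G$. $G-v$ denotes $G$ with $v$ and its incident edges removed; $G-G_1$ denotes $G$ with the vertices of $G_1$ (and incident edges) removed; for an induced subgraph $G_1$ and $v\notin V(G_1)$, $G_1+v$ is the subgraph induced by $V(G_1)\cup\{v\}$. *)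

(* Defs.v *)
From HB Require Import structures.
From mathcomp Require Import all_boot all_order all_algebra.

Set Implicit Arguments.
Unset Strict Implicit.
Unset Printing Implicit Defensive.

Import GRing.Theory Num.Theory.

Local Open Scope ring_scope.

(* Vertices live in an ambient finite type T, so that subgraphs of a graph are
   again objects of the same type. Edges are 2-element sets of vertices.
   [neg e] means that the edge e has sign -; the values of [neg] outside
   [edges] are junk and are never used. *)
Record signed_graph (T : finType) := SignedGraph {
  vertices : {set T};
  edges : {set {set T}};
  neg : {set T} -> bool;
  edges_sub : forall e, e \in edges -> e \subset vertices;
  edges_card : forall e, e \in edges -> #|e| = 2%N
}.

Section SignedGraph.

Variable T : finType.
Implicit Types (G H : signed_graph T) (A : {set T}) (v : T).

(* Irreflexive, since [set x; x] has only one element. *)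
Definition adj G : rel T := fun x y => [set x; y] \in edges G.

Lemma induced_sub G A e :
  e \in [set e in edges G | e \subset A] -> e \subset vertices G :&: A.
Proof. by rewrite inE subsetI => /andP[/edges_sub -> ->]. Qed.

Lemma induced_card G A e :
  e \in [set e in edges G | e \subset A] -> #|e| = 2%N.
Proof. by rewrite inE => /andP[/edges_card]. Qed.

Definition induced G A : signed_graph T :=
  SignedGraph (neg G) (@induced_sub G A) (@induced_card G A).

Definition del_vertex G v := induced G (vertices G :\ v).

Definition del_graph G H := induced G (vertices G :\: vertices H).

Definition add_vertex G H v := induced G (v |: vertices H).

Definition connected G :=
  [forall x in vertices G, forall y in vertices G, connect (adj G) x y].

(* Meant for connected G. *)
Definition cut_point G v := (v \in vertices G) && ~~ connected (del_vertex G v).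

Definition is_component H G :=
  exists2 x, x \in vertices G &
    H = induced G [set y in vertices G | connect (adj G) x y].

Section Nullity.

Variable R : realFieldType.

Definition adjmx G : 'M[R]_#|vertices G| :=
  \matrix_(i, j)
    let: e := [set enum_val i; enum_val j] in
    if e \in edges G then (-1) ^+ neg G e else 0.

(* Algebraic multiplicity of the eigenvalue 0. *)
Definition nullity G : nat := mup 0 (char_poly (adjmx G)).

End Nullity.

End SignedGraph.

(* Main.v *)
(** The adjacency matrix is real symmetric, so the nullity of a graph is the
    corank of its matrix. Write A1, b for the matrix of G1 and the column
    joining it to v. As the rank does not grow from G1 to G1 + v, b is in the
    column space of A1, say b = A1 x, and b^T x = 0. Since v is the only vertex
    outside G1 with neighbours in G1, subtracting the combination x of the G1
    rows and columns from those of v turns the matrix of G into the direct sum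
    of A1 and the matrix of G - G1. *)

Require Import Defs.
From mathcomp Require Import all_boot all_order all_algebra.

Import GRing.Theory Num.Theory.
Local Open Scope ring_scope.

Set Implicit Arguments.
Unset Strict Implicit.

(** * Corank and the multiplicity of 0 for symmetric matrices *)

(** The diagonal entries of [u *m u^T] are sums of squares, so the order on [R] kills every term. *)
Lemma mulmx_trmx_eq0 (R : realFieldType) (m n : nat) (u : 'M[R]_(m, n)) :
  u *m u^T = 0 -> u = 0.
Proof.
move=> u0; apply/matrixP=> i j; rewrite [RHS]mxE.
have /eqP := congr1 (fun M : 'M_m => M i i) u0; rewrite !mxE.
rewrite psumr_eq0 => [/allP/(_ j (mem_index_enum j))|k _].
  by rewrite implyTb mxE mulf_eq0 orbb => /eqP.
by rewrite mxE -expr2 sqr_ge0.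
Qed.

(** If [u = D A] and [u A = 0], then [u u^T = u A D^T = 0] by symmetry, so the row space of [A]
    meets its kernel trivially. *)
Lemma mxrank_sym_sqr (R : realFieldType) (n : nat) (A : 'M[R]_n) :
  A^T = A -> \rank (A *m A) = \rank A.
Proof.
move=> symA; rewrite -[RHS](mxrank_mul_ker A A).
suff -> : (A :&: kermx A)%MS = 0 by rewrite mxrank0 addn0.
apply: mulmx_trmx_eq0.
have /submxP[D uA] : (A :&: kermx A <= A)%MS by exact: capmxSl.
have /sub_kermxP Au : (A :&: kermx A <= kermx A)%MS by exact: capmxSr.
by rewrite {1}uA -{1}symA -mulmxA -trmx_mul Au trmx0 mulmx0.
Qed.

(** Sylvester's identity: clearing [c] in the block matrix [M] by column operations yields
    ['X - b c], by row operations ['X - c b]. Scaling the lower rows by ['X] avoids dividing by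
    it. *)
Lemma char_poly_mulmxC (R : comNzRingType) (m n : nat)
    (B : 'M[R]_(m, n)) (C : 'M[R]_(n, m)) :
  'X^n * char_poly (B *m C) = 'X^m * char_poly (C *m B).
Proof.
rewrite /char_poly /char_poly_mx !map_mxM.
set b := map_mx _ B; set c := map_mx _ C.
pose M := block_mx 'X%:M b c 1%:M.
have <- : \det M = \det ('X%:M - b *m c).
  have -> : \det M = \det (M *m block_mx 1%:M 0 (- c) 1%:M).
    by rewrite det_mulmx det_lblock !det1 !mulr1.
  rewrite mulmx_block !mulmx1 !mulmx0 mul1mx mulmxN subrr !add0r.
  by rewrite det_ublock det1 mulr1.
have -> : 'X^n * \det M = \det (block_mx 1%:M 0 (- c) 'X%:M *m M).
  by rewrite det_mulmx det_lblock det1 mul1r det_scalar.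
rewrite mulmx_block !mul1mx !mul0mx !addr0 mulNmx scalar_mxC addNr.
by rewrite mulmx1 addrC mulNmx det_ublock det_scalar.
Qed.

(* For a full-rank factorization A = B C, the matrix C B is invertible because
   A^2 has the rank of A, and it carries the nonzero part of the spectrum. *)
Lemma mup0_char_poly_sym (R : realFieldType) (n : nat) (A : 'M[R]_n) :
  A^T = A -> mup 0 (char_poly A) = (n - \rank A)%N.
Proof.
move=> symA; set r := \rank A.
have defA := mulmx_base A.
have CB_unit : row_base A *m col_base A \in unitmx.
  rewrite -row_full_unit /row_full eqn_leq rank_leq_row.
  rewrite -[X in (X <= _)%N](mxrank_sym_sqr symA) -{1 2}defA mulmxA.
  rewrite -!(mulmxA (col_base A)).
  by apply: leq_trans (mxrankM_maxr _ _) (mxrankM_maxl _ _).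
have nroot : ~~ root (char_poly (row_base A *m col_base A)) 0.
  rewrite rootE horner_coef0 char_poly_det mulf_eq0 signr_eq0 /=.
  by rewrite -unitfE -unitmxE.
(* The multiplicity of 0 is compared on both sides: [r] plus the wanted one equals [n], since the
   factor of size [r] does not vanish at 0. *)
have := congr1 (mup 0) (char_poly_mulmxC (col_base A) (row_base A)).
rewrite defA !mupM ?monic_neq0 ?char_poly_monic ?monicXn //.
rewrite (mupNroot nroot) -['X]subr0 !mup_XsubCX eqxx addn0 => rE.
by rewrite -[X in (X - _)%N]rE addKn.
Qed.

(** * Rank and complementary projections *)

(** Right multiplication by [P] fixes the rows of [M1] and kills those of [M2], so their row spaces
    are independent; left multiplication by [P] and [Q] recovers both from the sum. *)
Lemma mxrank_sum_compl (F : fieldType) (n : nat) (P W : 'M[F]_n) :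
  P *m P = P ->
  let Q := 1%:M - P in
  \rank (P *m W *m P + Q *m W *m Q)%R
    = (\rank (P *m W *m P) + \rank (Q *m W *m Q))%N.
Proof.
move=> PP Q; set M1 := P *m W *m P; set M2 := Q *m W *m Q.
have PQ : P *m Q = 0 by rewrite mulmxBr mulmx1 PP subrr.
have QP : Q *m P = 0 by rewrite mulmxBl mul1mx PP subrr.
have QQ : Q *m Q = Q by rewrite {1}/Q mulmxBl mul1mx PQ subr0.
have M1P : M1 *m P = M1 by rewrite -[LHS]mulmxA PP.
have M2Q : M2 *m Q = M2 by rewrite -[LHS]mulmxA QQ.
rewrite -mxrank_disjoint_sum; last first.
  have /submxP[D1 E1] := capmxSl M1 M2.
  have /submxP[D2 E2] := capmxSr M1 M2.
  by rewrite E1 -M1P mulmxA -E1 E2 -M2Q -!mulmxA QP !mulmx0.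
apply/eqP; rewrite eqn_leq; apply/andP; split; apply: mxrankS.
  by rewrite addmx_sub_adds.
have PM : P *m (M1 + M2) = M1.
  by rewrite mulmxDr !mulmxA PP PQ !mul0mx addr0.
have QM : Q *m (M1 + M2) = M2.
  by rewrite mulmxDr !mulmxA QP QQ !mul0mx add0r.
rewrite addsmx_sub; apply/andP; split.
  by rewrite -{1}PM submxMl.
by rewrite -{1}QM submxMl.
Qed.

(* If bordering [P W P] by the row and column of [W] at [e] does not raise the
   rank, then [e W P = y P W] for some [y] with [y e^T = 0], so the congruence
   by the transvection [1 - e^T y] clears the border and nothing else. *)
Lemma mxrank_cut (F : fieldType) (n : nat) (W P : 'M[F]_n) (e : 'rV[F]_n) :
  let Q := 1%:M - P in
  let K := P + e^T *m e in
  W^T = W -> P^T = P -> P *m P = P ->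
  e *m P = 0 -> e *m e^T = 1%:M -> e *m W *m e^T = 0 ->
  P *m W *m (1%:M - K) = 0 ->
  \rank (K *m W *m K) = \rank (P *m W *m P) ->
  \rank W = (\rank (P *m W *m P) + \rank (Q *m W *m Q))%N.
Proof.
move=> Q K symW symP PP eP ee eWe noedge rankK.
rewrite -mxrank_sum_compl // -/Q.
set M1 := P *m W *m P; set M2 := Q *m W *m Q; pose b := e *m W *m P.
have QP : Q *m P = 0 by rewrite mulmxBl mul1mx PP subrr.
have Pe : P *m e^T = 0 by rewrite -symP -trmx_mul eP trmx0.
have bT : b^T = P *m W *m e^T by rewrite !trmx_mul symP symW mulmxA.
have PW : P *m W = M1 + b^T *m e.
  move/eqP: noedge; rewrite mulmxBr mulmx1 subr_eq0 => /eqP->.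
  by rewrite mulmxDr bT !mulmxA.
have WP : W *m P = M1 + e^T *m b.
  rewrite -[LHS]trmxK trmx_mul symP symW PW linearD /= /M1.
  by rewrite !trmx_mul !trmxK symP symW mulmxA.
have PK : P *m K = P by rewrite mulmxDr PP mulmxA Pe mul0mx addr0.
have eK : e *m K = e by rewrite mulmxDr eP add0r mulmxA ee mul1mx.
have PWK : P *m (K *m W *m K) = M1 + b^T *m e.
  by rewrite !mulmxA PK PW mulmxDl -!mulmxA PK eK mulmxA.
have bK : b = e *m (K *m W *m K).
  by rewrite !mulmxA eK mulmxDr mulmxA eWe mul0mx addr0.
have PWKP : P *m (K *m W *m K) *m P = M1.
  by rewrite PWK mulmxDl -[M1 *m P]mulmxA PP -(mulmxA _ e) eP mulmx0 addr0.
(* Left multiplication by [P] could only shrink the row space, but a further [P] on the right still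
   leaves [M1], whose rank is that of [K W K]. *)
have subK : (K *m W *m K <= P *m (K *m W *m K))%MS.
  rewrite -(mxrank_leqif_sup (submxMl _ _)) eqn_leq mxrankS ?submxMl //=.
  by rewrite rankK -/M1 -{1}PWKP mxrankM_maxl.
have /submxP[z bz] : (b <= P *m (K *m W *m K))%MS.
  by rewrite bK (submx_trans (submxMl _ _)).
(* Absorbing [P] into the witness makes it orthogonal to [e]. *)
pose y := z *m P.
have yP : y *m P = y by rewrite -mulmxA PP.
have ye : y *m e^T = 0 by rewrite -mulmxA Pe mulmx0.
have ey : e *m y^T = 0 by rewrite -[e]trmxK -trmx_mul ye trmx0.
have yW : y *m W = b by rewrite bz PWK -PW mulmxA.
have byM : b = y *m M1 by rewrite !mulmxA yP yW -mulmxA PP.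
have M1y : M1 *m y^T = b^T by rewrite byM trmx_mul !trmx_mul symP symW !mulmxA.
have M2y : M2 *m y^T = 0.
  by rewrite -yP trmx_mul symP mulmxA -(mulmxA _ Q) QP mulmx0 mul0mx.
pose S := 1%:M - e^T *m y.
have S_unit : S \in unitmx.
  suff /mulmx1_unit[] : S *m (1%:M + e^T *m y) = 1%:M by [].
  have eyy : e^T *m y *m (e^T *m y) = 0.
    by rewrite -mulmxA (mulmxA y) ye mul0mx mulmx0.
  by rewrite mulmxBl mul1mx mulmxDr mulmx1 eyy addr0 addrK.
have defW : W = M1 + b^T *m e + e^T *m b + M2.
  rewrite /M2 mulmxBl mul1mx mulmxBr mulmx1 mulmxBl -/M1 PW WP.
  by rewrite [M1 + _ *m b]addrC addrK -[W - _ - _]addrA -opprD [RHS]addrC subrK.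
have SW : S *m W = M1 + b^T *m e + M2.
  by rewrite mulmxBl mul1mx -mulmxA yW {1}defW addrAC addrK.
have SWS : S *m W *m S^T = M1 + M2.
  have -> : S^T = 1%:M - y^T *m e.
    by rewrite /S linearB /= trmx1 trmx_mul trmxK.
  rewrite SW mulmxBr mulmx1 mulmxA !mulmxDl M1y M2y -(mulmxA b^T).
  rewrite ey !mulmx0 !mul0mx !addr0.
  by rewrite addrAC addrK.
rewrite -SWS mxrankMfree ?row_free_unit ?unitmx_tr //.
by rewrite (eqmxMfull _ _) // row_full_unit.
Qed.

(** * Adjacency matrices padded to the ambient type *)

(* Indexed by the whole ambient type, so that an induced subgraph has the matrix
   [P A P] with [P] a coordinate projection. *)
Definition padmx (R : comNzRingType) (T : finType) (G : signed_graph T) :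
    'M[R]_#|T| :=
  \matrix_(i, j)
    let: e := [set enum_val i; enum_val j] in
    if e \in edges G then (-1) ^+ neg G e else 0.

Definition projmx (R : comNzRingType) (T : finType) (A : {set T}) :
    'M[R]_#|T| :=
  diag_mx (\row_i (enum_val i \in A)%:R).

Lemma projmx_sandwich (R : comNzRingType) (T : finType) (A B : {set T})
    (M : 'M[R]_#|T|) i j :
  (projmx R A *m M *m projmx R B) i j
    = if (enum_val i \in A) && (enum_val j \in B) then M i j else 0.
Proof.
rewrite mul_mx_diag mul_diag_mx !mxE.
by case: (_ \in A); case: (_ \in B); rewrite ?mul1r ?mul0r ?mulr1 ?mulr0.
Qed.

Lemma projmxI (R : comNzRingType) (T : finType) (A B : {set T}) :
  projmx R A *m projmx R B = projmx R (A :&: B).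
Proof.
rewrite mulmx_diag; congr diag_mx; apply/rowP=> i.
by rewrite !mxE inE -natrM mulnb.
Qed.

Lemma projmxC (R : comNzRingType) (T : finType) (A : {set T}) :
  projmx R (~: A) = 1%:M - projmx R A.
Proof.
apply/matrixP=> i j; rewrite !mxE inE.
case: (i == j); rewrite ?mulr0n ?subr0 //.
by case: (_ \in A); rewrite ?subrr ?subr0.
Qed.

Lemma projmxU1 (R : comNzRingType) (T : finType) (A : {set T}) (v : T) :
  v \notin A ->
  let e : 'rV[R]_#|T| := delta_mx 0 (enum_rank v) in
  projmx R (v |: A) = projmx R A + e^T *m e.
Proof.
move=> vA e; rewrite trmx_delta mul_delta_mx.
apply/matrixP=> i j; rewrite !mxE !inE -!(can2_eq enum_valK enum_rankK).
have [-> | ij] := eqVneq i j; last first.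
  rewrite !mulr0n add0r; case: eqP => //= iv; case: eqP => // jv.
  by case/eqP: ij; apply: enum_val_inj; rewrite iv jv.
rewrite !mulr1n; case: eqP => [->|_]; last by rewrite addr0.
by rewrite (negPf vA) add0r.
Qed.

Lemma padmx_sym (R : comNzRingType) (T : finType) (G : signed_graph T) :
  (padmx R G)^T = padmx R G.
Proof. by apply/matrixP=> i j; rewrite !mxE setUC. Qed.

Lemma padmx_diag (R : comNzRingType) (T : finType) (G : signed_graph T) i :
  padmx R G i i = 0.
Proof.
rewrite mxE setUid; case: ifP => // /edges_card.
by rewrite cards1.
Qed.

Lemma padmx_induced (R : comNzRingType) (T : finType) (G : signed_graph T)
    (A : {set T}) :
  padmx R (induced G A) = projmx R A *m padmx R G *m projmx R A.
Proof.
apply/matrixP=> i j; rewrite projmx_sandwich !mxE inE subUset !sub1set.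
by case: (_ \in edges G); case: (_ \in A) => //=; case: (_ \in A).
Qed.

Lemma padmx_vertices (R : comNzRingType) (T : finType) (G : signed_graph T) :
  projmx R (vertices G) *m padmx R G *m projmx R (vertices G) = padmx R G.
Proof.
apply/matrixP=> i j; rewrite projmx_sandwich !mxE.
case: ifPn => // Nij; case: ifP => // /edges_sub.
by rewrite subUset !sub1set (negPf Nij).
Qed.

(** With [E] selecting the rows of the vertices, [E^T E] is the projection onto them, so each matrix
    is a two-sided multiple of the other. *)
Lemma mxrank_padmx (R : realFieldType) (T : finType) (G : signed_graph T) :
  \rank (adjmx R G) = \rank (padmx R G).
Proof.
pose f (k : 'I_#|vertices G|) : 'I_#|T| := enum_rank (enum_val k).
pose E : 'M[R]_(_, #|T|) := rowsub f 1%:M.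
have adjE : adjmx R G = E *m padmx R G *m E^T.
  rewrite /E mul_rowsub_mx mul1mx trmx_mxsub trmx1 mulmx_colsub mulmx1.
  by apply/matrixP=> i j; rewrite !mxE !enum_rankK.
have EE : E^T *m E = projmx R (vertices G).
  apply/matrixP=> i j; rewrite !mxE.
  under eq_bigr do rewrite !mxE -natrM mulnb.
  have [iV | iNV] := boolP (enum_val i \in vertices G).
    rewrite (bigD1 (enum_rank_in iV (enum_val i))) //= big1 => [|k ki].
      by rewrite /f enum_rankK_in // enum_valK eqxx addr0.
    rewrite (_ : f k == i = false) //; apply: contraNF ki => /eqP fk.
    by apply/eqP/enum_val_inj; rewrite enum_rankK_in // -fk enum_rankK.
  rewrite mul0rn big1 // => k _; rewrite (_ : f k == i = false) //.
  by apply: contraNF iNV => /eqP <-; rewrite enum_rankK enum_valP.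
apply/eqP; rewrite eqn_leq; apply/andP; split.
  by rewrite adjE (leq_trans (mxrankM_maxl _ _)) // mxrankM_maxr.
rewrite -padmx_vertices -EE -!mulmxA (mulmxA (padmx R G)) (mulmxA E).
rewrite [E *m (_ *m _)]mulmxA -adjE.
by rewrite (leq_trans (mxrankM_maxr _ _)) // mxrankM_maxl.
Qed.

(** * Nullity across a cut vertex *)

(** The additive form lets nullities be compared by cancellation, without truncated subtraction. *)
Lemma nullityE (R : realFieldType) (T : finType) (G : signed_graph T) :
  (nullity R G + \rank (padmx R G) = #|vertices G|)%N.
Proof.
rewrite -mxrank_padmx /nullity mup0_char_poly_sym ?subnK ?rank_leq_row //.
by apply/matrixP=> i j; rewrite !mxE setUC.
Qed.

(** Adding [v] to [C] raises order and nullity by one each, hence keeps the rank; [mxrank_cut] then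
    applies with [e] the unit vector at [v]. *)
Lemma nullity_cut (R : realFieldType) (T : finType) (G : signed_graph T)
    (C : {set T}) (v : T) :
    C \subset vertices G :\ v -> v \in vertices G ->
    (forall x y, x \in C -> adj G x y -> y \in v |: C) ->
    nullity R (induced G (v |: C)) = (nullity R (induced G C)).+1 ->
  nullity R G
    = (nullity R (induced G C) + nullity R (induced G (vertices G :\: C)))%N.
Proof.
rewrite subsetD1 => /andP[CV vC] vV closedC nullC.
have vCV : v |: C \subset vertices G by rewrite subUset sub1set vV.
have := nullityE R (induced G (vertices G :\: C)).
have := nullityE R (induced G (v |: C)); have := nullityE R (induced G C).
rewrite /= (setIidPr CV) (setIidPr vCV) (setIidPr (subsetDl _ _)).
rewrite cardsU1 vC nullC => n1 n1v n2.
have cardV : (#|C| + #|vertices G :\: C| = #|vertices G|)%N.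
  by rewrite -(cardsID C (vertices G)) (setIidPr CV).
suff: \rank (padmx R G) = (\rank (padmx R (induced G C))
        + \rank (padmx R (induced G (vertices G :\: C))))%N.
  move=> rkG; have := nullityE R G; rewrite rkG -cardV -n1 -n2 addnACA.
  by move/addIn.
have -> : padmx R (induced G (vertices G :\: C))
    = (1%:M - projmx R C) *m padmx R G *m (1%:M - projmx R C).
  rewrite padmx_induced -[in RHS]padmx_vertices -projmxC !mulmxA projmxI.
  by rewrite -(mulmxA _ _ (projmx R (~: C))) projmxI [~: C :&: _]setIC -setDE.
rewrite padmx_induced.
apply: (@mxrank_cut _ _ _ _ (delta_mx 0 (enum_rank v))).
- exact: padmx_sym.
- exact: tr_diag_mx.
- by rewrite projmxI setIid.
- apply/rowP=> j; rewrite mul_mx_diag !mxE /=.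
  have [->|_] := eqVneq; last by rewrite mul0r.
  by rewrite enum_rankK (negPf vC) mulr0.
- by rewrite trmx_delta mul_delta_mx; apply/matrixP=> i j; rewrite !ord1 !mxE.
(* This is the diagonal entry at [v], zero because there are no loops. *)
- rewrite trmx_delta -rowE -colE; apply/matrixP=> i j.
  by rewrite mxE mxE padmx_diag mxE.
- rewrite -projmxU1 // -projmxC; apply/matrixP=> i j.
  rewrite projmx_sandwich !mxE inE; case: ifP => // /andP[iC jNC].
  case: ifP => // ij; case/negP: jNC.
  by apply: closedC iC _.
rewrite -projmxU1 // -!padmx_induced.
by apply: (@addnI (nullity R (induced G C)).+1); rewrite n1v addSn n1.
Qed.

Theorem theorem3p2 (R : realFieldType) (T : finType) (n : nat)
    (G G1 : signed_graph T) (v : T) :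
  #|vertices G| = n ->
  connected G ->
  cut_point G v ->
  is_component G1 (del_vertex G v) ->
  ((nullity R G1)%:Z = (nullity R (add_vertex G G1 v))%:Z - 1)%R ->
  nullity R G = (nullity R G1 + nullity R (del_graph G G1))%N.
Proof.
move=> _ _ /andP[vV _] [x _ ->].
set C := [set y in _ | _].
have CV : C \subset vertices G :\ v.
  by apply/subsetP=> y; rewrite !inE => /andP[/andP[_ ->]].
have VC : vertices (induced (del_vertex G v) C) = C.
  by apply/setIidPr/(subset_trans CV); rewrite subsetI subsetDl subxx.
(* Inducing in two stages gives a different record, but the same vertex count and padded matrix,
   which determine the nullity. *)
have -> : nullity R (induced (del_vertex G v) C) = nullity R (induced G C).
  have := nullityE R (induced (del_vertex G v) C).
  have := nullityE R (induced G C).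
  rewrite VC /= (setIidPr (subset_trans CV (subsetDl _ _))) => <-.
  rewrite !padmx_induced !mulmxA projmxI -(mulmxA _ _ (projmx R C)) projmxI.
  by rewrite setIC (setIidPr CV) => /addIn.
rewrite /add_vertex /del_graph VC => nullC.
apply: nullity_cut CV vV _ _.
  (* A neighbour [z] other than [v] of a vertex of the component survives in [G - v], so the path
     from [x] extends to it. *)
  move=> y z yC yz; rewrite !inE; case: eqVneq => //= zv.
  have zV : z \in vertices G.
    by have /edges_sub := yz; rewrite subUset !sub1set => /andP[].
  move: yC; rewrite !inE zV => /andP[/andP[yV /andP[yv _]] xy] /=.
  rewrite (connect_trans xy) // connect1 // /adj /= inE.
  by rewrite -/(adj G y z) yz subUset !sub1set !inE yv yV zv zV.
by apply/eqP; rewrite -eqz_nat -addn1 PoszD nullC subrK.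
Qed.
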